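(* Let $(X,T,S)$ be a minimal, distal $\mathbb{Z}^2$-system. The map $\mathcal{I}:X^2\to 2^X$ defined by $\mathcal{I}(x,y)=D_T(x)\cap D_S(y)$ is continuous.
   Context: A $\mathbb{Z}^2$-system $(X,T,S)$ is a compact metric space $(X,d_X)$ together with two commuting homeomorphisms $T,S:X\to X$. It is minimal if for every $x\in X$ the orbit $\{T^tS^sx : t,s\in\mathbb{Z}\}$ is dense in $X$, and distal if for all distinct $x,y\in X$, $\inf_{t,s\in\mathbb{Z}}d_X(T^tS^sx,T^tS^sy)>0$. For a homeomorphism $R$ of $X$ and $x\in X$, the prolongation class of $x$ under $R$ is $$D_R(x)=\Big\{y\in X : \exists (x_n)_n\subseteq X,\ \exists (k_n)_n\subseteq\mathbb{Z},\ \lim_{n\to\infty}x_n=x\text{ and }\lim_{n\to\infty}R^{k_n}x_n=y\Big\}.$$ $2^X$ denotes the space of non-empty, closed subsets of $X$ with the Hausdorff metric. (In a minimal, distal $\mathbb{Z}^2$-system the set $D_T(x)\cap D_S(y)$ is non-empty and closed for all $x,y\in X$, so $\mathcal{I}$ is well defined.) *)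

(* Defs.v *)
From HB Require Import structures.
From mathcomp Require Import all_boot all_order all_algebra.
From mathcomp Require Import all_classical all_reals.
From mathcomp Require Import topology normedtype.

Set Implicit Arguments.
Unset Strict Implicit.
Unset Printing Implicit Defensive.

Import Order.TTheory GRing.Theory Num.Theory.
Import numFieldNormedType.Exports.
Local Open Scope classical_set_scope.
Local Open Scope ring_scope.

HB.mixin Record Metric_isCompact (R : realType) X & Metric R X := {
  compact_setT : compact [set: X]
}.

#[short(type="compactMetricType")]
HB.structure Definition CompactMetric (R : realType) :=
  { X of Metric R X & Metric_isCompact R X }.

Record hyperspace (R : realType) (X : compactMetricType R) := Hyperspace {
  hyperspace_set :> set X ;
  hyperspace_neq0 : hyperspace_set !=set0 ;
  hyperspace_closed : closed hyperspace_set
}.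

Section HausdorffMetric.
Context (R : realType) (X : compactMetricType R).
Implicit Types (x y : X) (A B C : hyperspace X).

(* All the infima and suprema below are taken over non-empty sets of reals
   that are bounded, because X is compact. *)
Definition dist_to x (A : set X) : R := inf [set mdist x a | a in A].

Definition excess (A B : set X) : R := sup [set dist_to a B | a in A].

Definition hausdorff_dist (A B : set X) : R := Num.max (excess A B) (excess B A).

Lemma hyperspace_inj A B : A = B :> set X -> A = B.
Proof.
case: A B => [A A0 cA] [B B0 cB] /= AB; case: _ / AB in B0 cB *.
by rewrite (Prop_irrelevance A0 B0) (Prop_irrelevance cA cB).
Qed.

Lemma compact_mdist_bounded : exists M : R, forall x y, mdist x y <= M.
Proof.
have [[x0]|X0] := pselect (inhabited X); last first.
  by exists 0 => x; exfalso; apply: X0; exists.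
have mdist_cont : continuous (fun x => mdist x0 x : R^o).
  move=> x; apply/cvgrPdist_lt => e e0.
  have xe : \forall y \near x, mdist x y < e.
    by apply/metricType_numDomainType.nbhs_mdistP; exists e.
  near=> y; rewrite ltr_distlC.
  have xy : mdist x y < e by near: y.
  have := metric_triangle x0 x y; have := metric_triangle x0 y x.
  rewrite (metric_sym y x) => h1 h2.
  rewrite ltrBlDr (le_lt_trans h1) ?ltrD2l//=.
  by rewrite (le_lt_trans h2) ?ltrD2l.
have /compact_bounded[M [_ hM]] :
    compact ((fun x => mdist x0 x : R^o) @` [set: X]).
  apply: continuous_compact; last exact: compact_setT.
  exact: continuous_subspaceT.
have hM1 x : mdist x0 x <= M + 1.
  have := hM (M + 1); rewrite ltrDl ltr01 => /(_ isT (mdist x0 x)) h.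
  by rewrite (le_trans (ler_norm _))// h//; exists x.
exists ((M + 1) + (M + 1)) => x y.
by rewrite (le_trans (metric_triangle x x0 y))// lerD// metric_sym.
Unshelve. all: by end_near. Qed.

Lemma dist_to_le x (A : set X) a : A a -> dist_to x A <= mdist x a.
Proof.
move=> Aa; apply: ge_inf; last by exists a.
by exists 0 => _ [b _ <-]; exact: mdist_ge0.
Qed.

Lemma le_dist_to x (A : set X) r :
  A !=set0 -> (forall a, A a -> r <= mdist x a) -> r <= dist_to x A.
Proof.
move=> [a Aa] h; apply: lb_le_inf; first by exists (mdist x a), a.
by move=> _ [b Ab <-]; exact: h.
Qed.

Lemma dist_to_le_excess A B a : (A : set X) a -> dist_to a B <= excess A B.
Proof.
move=> Aa; have [M hM] := compact_mdist_bounded.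
apply: sup_upper_bound; last by exists a.
split; first by exists (dist_to a B), a.
exists M => _ [c _ <-]; have [b Bb] := hyperspace_neq0 B.
exact: le_trans (dist_to_le _ Bb) _.
Qed.

Lemma excess_le A B r :
  (forall a, (A : set X) a -> dist_to a B <= r) -> excess A B <= r.
Proof.
move=> h; have [a Aa] := hyperspace_neq0 A.
apply: ge_sup; first by exists (dist_to a B), a.
by move=> _ [c Ac <-]; exact: h.
Qed.

Lemma dist_to_ge0 x A : 0 <= dist_to x A.
Proof. by apply: (le_dist_to (hyperspace_neq0 A)) => a _; exact: mdist_ge0. Qed.

Lemma excess_ge0 A B : 0 <= excess A B.
Proof.
have [a Aa] := hyperspace_neq0 A.
exact: le_trans (dist_to_ge0 a B) (dist_to_le_excess B Aa).
Qed.

Lemma excessxx A : excess A A = 0.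
Proof.
apply/eqP; rewrite eq_le excess_ge0 andbT; apply: excess_le => a Aa.
by rewrite (le_trans (dist_to_le a Aa))// mdistxx.
Qed.

Lemma excess0_subset A B : excess A B <= 0 -> A `<=` B.
Proof.
move=> AB a Aa; apply: hyperspace_closed => U.
rewrite -metricType_numDomainType.filter_from_mdist_nbhs => -[e /= e0 eU].
have : dist_to a B < e.
  by rewrite (le_lt_trans (dist_to_le_excess B Aa))// (le_lt_trans AB).
move=> /inf_lt [|_ [b Bb <-] abe].
  by have [b Bb] := hyperspace_neq0 B; exists (mdist a b), b.
by exists b; split => //; exact: eU.
Qed.

Lemma excess_triangle B A C : excess A C <= excess A B + excess B C.
Proof.
apply: excess_le => a Aa.
rewrite -lerBlDr (le_trans _ (dist_to_le_excess B Aa))//.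
apply: (le_dist_to (hyperspace_neq0 B)) => b Bb.
rewrite lerBlDr -lerBlDl.
rewrite (le_trans _ (dist_to_le_excess C Bb))//.
apply: (le_dist_to (hyperspace_neq0 C)) => c Cc.
rewrite lerBlDl (le_trans (dist_to_le a Cc))//; exact: metric_triangle.
Qed.

HB.instance Definition _ := gen_eqMixin (hyperspace X).
HB.instance Definition _ := gen_choiceMixin (hyperspace X).

Let hdist A B := hausdorff_dist A B.

Let hdistxx A : hdist A A = 0.
Proof. by rewrite /hdist /hausdorff_dist excessxx maxxx. Qed.

Let hdist_positivity A B : hdist A B = 0 -> A = B.
Proof.
rewrite /hdist /hausdorff_dist => AB0; apply: hyperspace_inj.
have : Num.max (excess A B) (excess B A) <= 0 by rewrite AB0.
rewrite ge_max => /andP[AB BA].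
by apply/seteqP; split; exact: excess0_subset.
Qed.

Let hdist_sym A B : hdist A B = hdist B A.
Proof. by rewrite /hdist /hausdorff_dist maxC. Qed.

Let hdist_triangle B A C : hdist A C <= hdist A B + hdist B C.
Proof.
rewrite /hdist /hausdorff_dist ge_max; apply/andP; split.
  by rewrite (le_trans (excess_triangle B A C))// lerD// le_max lexx.
rewrite (le_trans (excess_triangle B C A))// addrC.
by rewrite lerD// le_max lexx orbT.
Qed.

HB.instance Definition _ := @isMetric.Build R (hyperspace X)
  hdist hdistxx hdist_positivity hdist_sym hdist_triangle.

Lemma mdist_hyperspaceE A B : mdist A B = hausdorff_dist A B.
Proof. by []. Qed.

End HausdorffMetric.

Record homeomorphism (X : topologicalType) := Homeomorphism {
  homeo_fun :> X -> X ;
  homeo_inv : X -> X ;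
  homeo_funK : cancel homeo_fun homeo_inv ;
  homeo_invK : cancel homeo_inv homeo_fun ;
  homeo_fun_continuous : continuous homeo_fun ;
  homeo_inv_continuous : continuous homeo_inv
}.

(* [Negz n] stands for the integer - n.+1. *)
Definition iterz (X : topologicalType) (F : homeomorphism X) (k : int) : X -> X :=
  match k with
  | Posz n => iter n F
  | Negz n => iter n.+1 (homeo_inv F)
  end.

Section Z2System.
Context (R : realType) (X : compactMetricType R).
Implicit Types (T S F : homeomorphism X).

Definition minimal T S :=
  forall x : X, dense [set iterz T ts.1 (iterz S ts.2 x) | ts in [set: int * int]].

Definition distal T S :=
  forall x y : X, x <> y ->
  0 < inf [set mdist (iterz T ts.1 (iterz S ts.2 x))
                     (iterz T ts.1 (iterz S ts.2 y)) | ts in [set: int * int]].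

Definition prolongation F (x : X) : set X :=
  [set y | exists (u : nat -> X) (k : nat -> int),
     u n @[n --> \oo] --> x /\ iterz F (k n) (u n) @[n --> \oo] --> y].

End Z2System.

(* Main.v *)
Require Import Defs.
From mathcomp Require Import all_boot all_order all_algebra.
From mathcomp Require Import all_classical all_reals.
From mathcomp Require Import interval_inference topology normedtype.

(** The set [D_T(x) `&` D_S(y)] is the fibre over [(x, y)] of the closed set [P]
    of triples [(x, y, z)] such that [(x, z)] lies in the closure of
    [{(u, T^k u)}] and [(y, z)] in the closure of [{(u, S^k u)}].  A map into
    the hyperspace of a compact space is continuous as soon as its graph is
    closed and the projection of that graph to the base is open
    ([hyperspace_continuous]), so the point is that [P -> X * X] is open;
    it is onto by minimality, so the fibres are non-empty.

    The commuting maps allow more freedom than the diagonal action: [P] is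
    invariant under [(T^a S^b, T^c S^d, T^c S^b)] for all integers [a b c d].
    Indeed the first and third coordinates are moved by powers of [T] that may
    differ and by the same power of [S], which preserves the closure of
    [{(u, T^k u)}]; the second and third coordinates are moved by the same power
    of [T].  On the first two coordinates this is the full product action on
    [X * X], which is minimal because [X] is.  It is distal on triples, because
    each coordinate is moved by an element of the distal action on [X].

    It remains to see that an invariant closed set [P] of a distal system projects
    openly onto a minimal base ([distal_extension_open]), which is Ellis' argument.
    The pointwise closure [E] of the acting maps is a compact semigroup whose
    elements are injective by distality; existence of idempotents in compact
    semigroups then turns [E] into a group ([enveloping_inverse]).  If [b'] tends
    to the image [b] of a point [z] of [P], minimality gives [p_b'] in [E] such
    that [p_b' z] lies over [b'].  Let [p0] be a cluster point of the [p_b'];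
    it preserves the fibre over [b], and so does its inverse, hence
    [w := p0^-1 z] lies in [P] over [b], and the points [p_b' w] of [P] lie over
    [b'] and cluster at [p0 w = z]. *)

Import Order.TTheory GRing.Theory Num.Theory.
Local Open Scope classical_set_scope.
Local Open Scope ring_scope.

Set Implicit Arguments.
Unset Strict Implicit.
Unset Printing Implicit Defensive.

(** * Generalities on topological spaces *)

Lemma closure_map (U V : topologicalType) (f : U -> V) (A : set U) (B : set V) :
  continuous f -> (forall x, A x -> closure B (f x)) ->
  forall x, closure A x -> closure B (f x).
Proof.
move=> cf AB x; rewrite closureE => /(_ (f @^-1` closure B)); apply.
by split=> //; apply: preimage_closed => [? _|]; [exact: cf|exact: closed_closure].
Qed.

Lemma pair_continuous (U V W : topologicalType) (f : U -> V) (g : U -> W) :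
  continuous f -> continuous g -> continuous (fun x => (f x, g x)).
Proof. by move=> cf cg x; apply: cvg_pair; [exact: cf|exact: cg]. Qed.

Lemma hausdorff_pair (U V : topologicalType) :
  hausdorff_space U -> hausdorff_space V -> hausdorff_space (U * V)%type.
Proof.
move=> hU hV [u v] [u' v'] clu; congr (_, _).
  apply: hU => A B nA nB.
  have [||[a b] [/= [Aa Bb]]] := clu (A `*` setT) (B `*` setT).
  - by exists (A, setT) => //; split=> //; exact: filterT.
  - by exists (B, setT) => //; split=> //; exact: filterT.
  - by move=> [? _]; exists a.
apply: hV => A B nA nB.
have [||[a b] [/= [Aa Bb]]] := clu (setT `*` A) (setT `*` B).
- by exists (setT, A) => //; split=> //; exact: filterT.
- by exists (setT, B) => //; split=> //; exact: filterT.
- by move=> [_ ?]; exists b.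
Qed.

Lemma compact_chain_meet (T : topologicalType) (K : set T) (C : set (set T)) :
  compact K -> K !=set0 -> total_on C subset ->
  (forall A, C A -> [/\ closed A, A !=set0 & A `<=` K]) ->
  exists2 x, K x & forall A, C A -> A x.
Proof.
move=> cK K0 Ctot CK.
have [[A0 CA0]|C0] := pselect (exists A, C A); last first.
  by have [x Kx] := K0; exists x => // A CA; case: C0; exists A.
have PC : ProperFilter (filter_from C id).
  apply: filter_from_proper => [|A /CK[_ A1 _] //].
  apply: filter_from_filter; first by exists A0.
  move=> A B CA CB; have [AB|BA] := Ctot A B CA CB.
    by exists A => // x Ax; split=> //; exact: AB.
  by exists B => // x Bx; split=> //; exact: BA.
have [|x [Kx clx]] := cK _ PC; first by exists A0 => //; have [] := CK _ CA0.
exists x => // A CA; have [clA _ _] := CK _ CA; apply: clA => V nV.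
by apply: (clx A V _ nV); exists A.
Qed.

(** * The enveloping semigroup of a distal family *)

(** The lemma of Ellis and Numakura.  A minimal closed subsemigroup [L] exists by
    Zorn's lemma, applied to complements in [K].  For [r] in [L] the closed
    subsemigroup [L r] is all of [L], so [s r = r] for some [s] in [L]; then
    the elements of [L] fixing [r] on the left form a closed subsemigroup, hence
    all of [L], and [r] itself is one of them. *)
Lemma compact_semigroup_idempotent (T : topologicalType) (m : T -> T -> T)
    (K : set T) :
  hausdorff_space T -> associative m -> (forall r, continuous (m^~ r)) ->
  compact K -> K !=set0 -> (forall p q, K p -> K q -> K (m p q)) ->
  exists2 e, K e & m e e = e.
Proof.
move=> hT mA cm cK K0 Km.
have clK : closed K by exact: compact_closed.
pose sub (A : set T) :=
  [/\ closed A, A !=set0 & forall p q, A p -> A q -> A (m p q)].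
have [C Csub Ctot|U [[clL L0 Lm] Umax]] :=
    @Zorn_bigcup T [set U | sub (K `\` U)].
  split.
  - have -> : K `\` \bigcup_(U in C) U = K `&` \bigcap_(U in C) (K `\` U).
      apply/seteqP; split=> x [Kx h]; split=> //.
        by move=> U CU; split=> // Ux; apply: h; exists U.
      by move=> [U CU Ux]; have [_] := h U CU; exact.
    by apply: closedI => //; apply: closed_bigI => U /Csub[].
  - have [|A [U CU <-]|x Kx hx] := @compact_chain_meet T K
        [set K `\` U | U in C] cK K0.
    + move=> _ _ [U CU <-] [V CV <-].
      by have [UV|VU] := Ctot U V CU CV; [right|left] => x [Kx nx]; split=> //;
        [move=> /UV|move=> /VU].
    + by have [? ? _] := Csub _ CU; split=> // x [].
    + exists x; split=> // -[U CU Ux]; have [|_] := hx (K `\` U); last exact.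
      by exists U.
  - move=> p q [Kp np] [Kq nq]; split; first exact: Km.
    move=> [U CU Um]; have [_ _ /(_ p q)[]//] := Csub _ CU.
    + by split=> // Up; apply: np; exists U.
    + by split=> // Uq; apply: nq; exists U.
set L := K `\` U in clL L0 Lm.
have cL : compact L by apply: (subclosed_compact clL cK) => x [].
have Lmin B : sub B -> B `<=` L -> L `<=` B.
  move=> sB BL x [Kx Ux]; apply: contrapT => nBx; apply: (Umax (~` B)).
    split; first by move=> y Uy /BL[].
    by move=> /(_ x nBx).
  rewrite /= setDE setCK; suff -> : K `&` B = B by [].
  by apply/seteqP; split=> [y []//|y By]; split=> //; have [] := BL _ By.
have [r Lr] := L0.
have LrE : L `<=` [set m s r | s in L].
  apply: Lmin.
  - split.
    + apply: compact_closed => //; apply: continuous_compact => //.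
      exact: continuous_subspaceT.
    + by exists (m r r), r.
    + by move=> _ _ [s Ls <-] [t Lt <-]; exists (m (m s r) t); [by apply: (Lm) => //; exact: (Lm)|rewrite !mA].
  - by move=> _ [s Ls <-]; exact: Lm.
have [s Ls sr] := LrE r Lr.
have fixr : L `<=` L `&` [set t | m t r = r].
  apply: Lmin; last by move=> x [].
  split.
  - apply: closedI => //.
    have -> : [set t | m t r = r] = (m^~ r) @^-1` [set r] by [].
    apply: preimage_closed => [? _|]; first exact: cm.
    by apply: compact_closed => //; exact: compact_set1.
  - by exists s.
  - by move=> p q [Lp /= pr] [Lq /= qr]; split; [exact: Lm|rewrite /= -mA qr].
exists r; first by have [] := Lr.
by have [] := fixr r Lr.
Qed.

Section EnvelopingSemigroup.
Context (Z : uniformType) (F : set (Z -> Z)).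

(** Ellis' enveloping semigroup, for the topology of pointwise convergence. *)
Definition enveloping : set {ptws Z -> Z} := closure (F : set {ptws Z -> Z}).

(** Distality in terms of the topology alone: the orbit closure of a pair of
    distinct points misses the diagonal. *)
Definition distal_family := forall x y w : Z,
  closure [set (f x, f y) | f in F] (w, w) -> x = y.

Lemma eval_continuous (z : Z) : continuous (fun p : {ptws Z -> Z} => p z).
Proof. exact: (@proj_continuous Z (fun=> Z) z). Qed.

Lemma ptws_continuous (W : topologicalType) (h : W -> {ptws Z -> Z}) :
  (forall z, continuous (fun w => h w z)) -> continuous h.
Proof.
move=> ch w.
have /(_ (h w) _)[_] := @pointwise_cvgP Z Z (h @ w).
by apply=> z; exact: ch.
Qed.

Definition compose (p q : {ptws Z -> Z}) : {ptws Z -> Z} := fun z => p (q z).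

Lemma compose_continuousl (r : {ptws Z -> Z}) : continuous (compose ^~ r).
Proof.
apply: ptws_continuous => z. exact: eval_continuous. Qed.

Context (cZ : compact [set: Z]) (hZ : hausdorff_space Z).

Lemma ptws_compact : compact [set: {ptws Z -> Z}].
Proof.
have := @tychonoff Z (fun=> Z) (fun=> setT) (fun=> cZ).
by congr (compact _); apply/seteqP; split.
Qed.

Lemma ptws_hausdorff : hausdorff_space {ptws Z -> Z}.
Proof. exact: (@hausdorff_product Z (fun=> Z) (fun=> hZ)). Qed.

Lemma enveloping_compact : compact enveloping.
Proof. exact: (subclosed_compact (@closed_closure _ _) ptws_compact). Qed.

Context (Fc : forall f, F f -> continuous f)
  (FM : forall f g, F f -> F g -> F (f \o g)) (Fd : distal_family).

(** Composition is continuous in its left argument only; in the right argument it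
    is so when the left one is a continuous map, such as a member of [F].  Closing
    up in the right argument first, then in the left one, suffices. *)
Lemma envelopingM p q : enveloping p -> enveloping q -> enveloping (compose p q).
Proof.
move=> Ep Eq; apply: (@closure_map _ _ (compose^~ q) F F) Ep.
  exact: compose_continuousl.
move=> f Ff; apply: (@closure_map _ _ (compose f) F F) Eq.
  by apply: ptws_continuous => z g; apply: (@continuous_comp _ _ _ (fun p : {ptws Z -> Z} => p z) f);
    [exact: eval_continuous|exact: Fc].
by move=> g Fg; apply: subset_closure; exact: FM.
Qed.

Lemma enveloping_inj p : enveloping p -> injective p.
Proof.
move=> Ep x y pxy; apply: (@Fd x y (p x)).
have : closure [set (f x, f y) | f in F] (p x, p y); last by rewrite -pxy.
apply: (@closure_map _ _ (fun p : {ptws Z -> Z} => (p x, p y)) F) Ep.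
  exact: pair_continuous (@eval_continuous x) (@eval_continuous y).
by move=> f Ff; apply: subset_closure; exists f.
Qed.

(** The left ideal [E p] is a compact semigroup, and an idempotent [q p] in it is
    the identity because it is injective. *)
Lemma enveloping_left_inverse p : enveloping p ->
  exists2 q, enveloping q & cancel p q.
Proof.
move=> Ep.
have [|||_ [q Eq <-] qpqp] := @compact_semigroup_idempotent {ptws Z -> Z} compose
   [set compose q p | q in enveloping] ptws_hausdorff (fun _ _ _ => erefl)
   compose_continuousl.
- apply: continuous_compact; last exact: enveloping_compact.
  by apply: continuous_subspaceT; exact: compose_continuousl.
- by exists (compose p p), p.
- move=> _ _ [q Eq <-] [r Er <-]; exists (compose (compose q p) r) => //.
  by apply: envelopingM => //; exact: envelopingM.
- exists q => // z; apply: (@enveloping_inj (compose q p)); first exact: envelopingM.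
  exact: (congr1 (fun p => p z) qpqp).
Qed.

Lemma enveloping_inverse p : enveloping p ->
  exists q, [/\ enveloping q, cancel p q & cancel q p].
Proof.
move=> Ep; have [q Eq pK] := enveloping_left_inverse Ep.
have [r Er qK] := enveloping_left_inverse Eq.
by exists q; split=> // z; rewrite -[LHS]qK pK qK.
Qed.

(** * Distal extensions of minimal systems *)

Context (B : topologicalType) (pi : Z -> B) (hB : hausdorff_space B)
  (cpi : continuous pi)
  (pieq : forall f z z', F f -> pi z = pi z' -> pi (f z) = pi (f z'))
  (pimin : forall z b, closure [set pi (f z) | f in F] b).

Lemma enveloping_fiber p z z' : enveloping p -> pi z = pi z' -> pi (p z) = pi (p z').
Proof.
move=> Ep zz'.
have cev x : continuous (fun p : {ptws Z -> Z} => pi (p x)).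
  by move=> q; apply: continuous_comp; [exact: eval_continuous|exact: cpi].
apply: hB => U V nU nV.
have [q [Fq [/= Uq Vq]]] := Ep _ (@filterI _ (nbhs p) _ _ _ (cev z p U nU) (cev z' p V nV)).
by exists (pi (q z)); split=> //; rewrite (@pieq q z z').
Qed.

Lemma enveloping_transitive z b : exists2 p, enveloping p & pi (p z) = b.
Proof.
suff : [set pi (p z) | p in enveloping] b by case=> p; exists p.
have : closed [set pi (p z) | p in enveloping].
  apply: compact_closed => //; apply: continuous_compact.
    apply: continuous_subspaceT => q.
    by apply: continuous_comp; [exact: eval_continuous|exact: cpi].
  exact: enveloping_compact.
apply => V nV; have [_ [[f Ff <-] Vf]] := @pimin z b V nV.
by exists (pi (f z)); split=> //; exists f => //; exact: subset_closure.
Qed.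

Context (P : set Z) (clP : closed P) (PF : forall f z, F f -> P z -> P (f z)).

Lemma enveloping_invariant p z : enveloping p -> P z -> P (p z).
Proof.
move=> Ep Pz.
have -> : P = closure P by apply/closure_id.
apply: (@closure_map _ _ (fun p : {ptws Z -> Z} => p z) F) Ep.
  exact: eval_continuous.
by move=> f Ff; apply: subset_closure; exact: PF.
Qed.

Lemma distal_extension_onto : P !=set0 -> forall b, exists2 z, P z & pi z = b.
Proof.
move=> [z Pz] b; have [p Ep pb] := enveloping_transitive z b.
by exists (p z) => //; exact: enveloping_invariant.
Qed.

(** If the base points missed by [U] accumulated at [pi z], a choice of elements
    [p b] of [E] carrying [z] over [b] would push the corresponding filter to the
    compact set [E], where a cluster point is invertible. *)
Lemma distal_extension_open z (U : set Z) : P z -> nbhs z U ->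
  \forall b \near pi z, exists2 w, P w /\ U w & pi w = b.
Proof.
move=> Pz nU; apply: contrapT => nopen.
pose bad := [set b | ~ exists2 w, P w /\ U w & pi w = b].
have clbad : closure bad (pi z).
  move=> V nV; apply: contrapT => VN; apply: nopen.
  apply: filterS nV => b Vb; apply: contrapT => bb.
  by apply: VN; exists b.
have /choice[p pP] b : exists p, enveloping p /\ pi (p z) = b.
  by have [p ? ?] := enveloping_transitive z b; exists p.
have PG := within_nbhs_proper clbad.
have [|p0 [Ep0 clp0]] := enveloping_compact (fmap_proper_filter p PG).
  by apply: (@filterE _ (within bad (nbhs (pi z)))) => b; have [] := pP b.
have cev x : continuous (fun p : {ptws Z -> Z} => p x) := @eval_continuous x.
have cpev x : continuous (fun p : {ptws Z -> Z} => pi (p x)).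
  by move=> q; apply: continuous_comp; [exact: eval_continuous|exact: cpi].
(* A cluster point of the [p b] preserves the fibre of [z], since [pi (p b z) = b]
   tends to [pi z] along the filter. *)
have p0z : pi (p0 z) = pi z.
  apply: hB => V W nV nW.
  have [|_ [[b Wb <-] /= Vb]] := clp0 [set p b | b in W] _ _ (cpev z p0 V nV).
    by apply: (@filterS _ (nbhs (pi z)) _ W) => // b Wb _; exists b.
  by exists b; split=> //; have [_ <-] := pP b.
have [q [Eq p0K qK]] := enveloping_inverse Ep0.
have piq : pi (q z) = pi z by rewrite -(enveloping_fiber Eq p0z) p0K.
(* The point [q z] replaces [z]: its translates by the [p b] stay in [P], lie over
   the bad [b], yet cluster at [p0 (q z) = z]. *)
have nUq : nbhs (p0 (q z)) U by rewrite qK.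
have [|_ [[b bb <-] /= Ub]] := clp0 [set p b | b in bad] _ _ (cev (q z) p0 U nUq).
  by apply: (@filterE _ (nbhs (pi z))) => b bb; exists b.
apply: bb; exists (p b (q z)); last by rewrite (enveloping_fiber (pP b).1 piq) (pP b).2.
by split=> //; apply: enveloping_invariant; [exact: (pP b).1|exact: enveloping_invariant].
Qed.

End EnvelopingSemigroup.

(** * Continuity of maps into the hyperspace *)

Section Hyperspace.
Context (R : realType) (X : compactMetricType R).
Import metricType_numDomainType.

(** The closed graph bounds the excess of [K b'] over [K b], the open projection
    that of [K b] over [K b']; compactness of [X] and of [K b] makes the local
    bounds uniform. *)
Lemma hyperspace_continuous (B : topologicalType) (K : B -> hyperspace X) :
  closed [set p : B * X | (K p.1 : set X) p.2] ->
  (forall b z (U : set X), (K b : set X) z -> nbhs z U ->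
     \forall b' \near b, (K b' : set X) `&` U !=set0) ->
  continuous K.
Proof.
move=> clK opK b; apply/cvgrPdist_le => e e0.
have nball z : \forall z' \near z, mdist z z' < e.
  by apply/nbhs_mdistP; exists e.
have upper : \forall b' \near b, [set: X] `<=`
    [set z | (K b' : set X) z -> dist_to z (K b) <= e].
  have /compact_near_coveringP := @compact_setT R X.
  apply => z _; have [Kz|nKz] := pselect ((K b : set X) z).
    exists ([set z' | mdist z z' < e], setT).
      by split; [exact: nball|exact: filterT].
    move=> [z' b'] [/= zz' _] _; apply: le_trans (dist_to_le z' Kz) _.
    by rewrite metric_sym ltW.
  have : nbhs (b, z) (~` [set p : B * X | (K p.1 : set X) p.2]).
    by apply: open_nbhs_nbhs; split=> //; exact: closed_openC.
  move=> [[A C] /= [nA nC] AC]; exists (C, A) => // -[z' b'] [/= Cz' Ab'] Kz'.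
  by have := AC (b', z') (conj Ab' Cz').
have lower : \forall b' \near b, (K b : set X) `<=`
    [set z | dist_to z (K b') <= e].
  have cK : compact (K b : set X).
    exact: subclosed_compact (@hyperspace_closed _ _ _) (@compact_setT R X) _.
  move/compact_near_coveringP: cK; apply => z Kz.
  have ne2 : \forall z' \near z, mdist z z' < e / 2.
    by apply/nbhs_mdistP; exists (e / 2) => //; rewrite /= divr_gt0.
  exists ([set z' | mdist z z' < e / 2],
          [set b' | (K b' : set X) `&` [set z' | mdist z z' < e / 2] !=set0]).
    by split; [exact: ne2|apply: opK Kz ne2].
  move=> [z' b'] [/= zz' [w [Kw zw]]]; apply: le_trans (dist_to_le z' Kw) _.
  apply: le_trans (metric_triangle z' z w) _.
  by rewrite metric_sym ltW// [ltRHS]splitr ltrD.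
near=> b'; rewrite mdist_hyperspaceE /hausdorff_dist ge_max.
apply/andP; split; apply: excess_le.
  by near: b'; exact: lower.
suff h : [set: X] `<=` [set z | (K b' : set X) z -> dist_to z (K b) <= e].
  by move=> z Kz; exact: h.
by near: b'; exact: upper.
Unshelve. all: by end_near. Qed.

End Hyperspace.

(** * Integer iterates and the prolongation relation *)

Section IntegerIterates.
Context (X : topologicalType).
Implicit Types (F G : homeomorphism X) (k l : int).

Lemma iterzS F k x : iterz F (k + 1) x = F (iterz F k x).
Proof.
case: k => [n|[|n]]; first by rewrite addrC.
  by rewrite /= homeo_invK.
have -> : Negz n.+1 + 1 = Negz n by rewrite !NegzE -[n.+2]addn1 PoszD opprD addrNK.
by rewrite /= homeo_invK.
Qed.

Lemma iterzD F k l x : iterz F (k + l) x = iterz F k (iterz F l x).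
Proof.
elim/int_rect: k => [|n IH|n IH]; first by rewrite add0r.
  by rewrite -addn1 PoszD addrAC !iterzS IH.
apply: (can_inj (@homeo_funK _ F)).
by rewrite -!iterzS addrAC -addn1 PoszD opprD addrNK IH.
Qed.

Lemma iterz_comm F (g : X -> X) : (forall x, F (g x) = g (F x)) ->
  forall k x, iterz F k (g x) = g (iterz F k x).
Proof.
move=> Fg; elim/int_rect => [//|n IH|n IH] x.
  by rewrite -addn1 PoszD !iterzS IH Fg.
apply: (can_inj (@homeo_funK _ F)).
by rewrite Fg -!iterzS -addn1 PoszD opprD addrNK IH.
Qed.

Lemma iterz_continuous F k : continuous (iterz F k).
Proof.
have iter_continuous (f : X -> X) n : continuous f -> continuous (iter n f).
  move=> cf; elim: n => [|n IH] x; first exact: cvg_id.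
  by apply: (@continuous_comp _ _ _ (iter n f) f); [exact: IH|exact: cf].
by case: k => n; apply: iter_continuous;
  [exact: homeo_fun_continuous|exact: homeo_inv_continuous].
Qed.

End IntegerIterates.

Section ProlongationGraph.
Context (R : realType) (X : compactMetricType R).
Import metricType_numDomainType.

Definition prolongation_graph (F : homeomorphism X) : set (X * X) :=
  closure [set (uk.1, iterz F uk.2 uk.1) | uk in [set: X * int]].

(** Sequences suffice to describe this closure because [X] is metric. *)
Lemma prolongationE F (x y : X) : prolongation F x y <-> prolongation_graph F (x, y).
Proof.
split=> [[u [k [ux ky]]] V nV|xy].
  have uky : (u n, iterz F (k n) (u n)) @[n --> \oo] --> (x, y) by exact: cvg_pair.
  near \oo => n; exists (u n, iterz F (k n) (u n)); split; first by exists (u n, k n).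
  by near: n; exact: uky.
have /choice[f fP] (n : nat) : exists uk : X * int,
    mdist x uk.1 < n.+1%:R^-1 /\ mdist y (iterz F uk.2 uk.1) < n.+1%:R^-1.
  have [|_ [[uk _ <-]] [/= h1 h2]] :=
    xy ([set z | mdist x z < n.+1%:R^-1] `*` [set z | mdist y z < n.+1%:R^-1]).
    exists ([set z | mdist x z < n.+1%:R^-1], [set z | mdist y z < n.+1%:R^-1]) => //.
    by split; apply/nbhs_mdistP; exists n.+1%:R^-1 => //=; rewrite invr_gt0.
  by exists uk.
exists (fun n => (f n).1), (fun n => (f n).2); split;
  apply/cvgrPdist_lt => e e0; near=> n.
  apply: lt_trans (fP n).1 _; near: n; exact: near_infty_natSinv_lt (PosNum e0).
apply: lt_trans (fP n).2 _; near: n; exact: near_infty_natSinv_lt (PosNum e0).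
Unshelve. all: by end_near. Qed.

End ProlongationGraph.

(** * The four-parameter action on linked triples *)

Section Z2Action.
Context (R : realType) (X : compactMetricType R) (T S : homeomorphism X).
Context (TS_comm : forall x : X, T (S x) = S (T x)).

Definition translate (a b : int) (x : X) : X := iterz T a (iterz S b x).

Lemma iterz_ST a b x : iterz S b (iterz T a x) = translate a b x.
Proof.
apply: iterz_comm => y; apply/esym.
by apply: iterz_comm.
Qed.

Lemma translateD a b c d x :
  translate (a + c) (b + d) x = translate a b (translate c d x).
Proof. by rewrite /translate !iterzD [in RHS]iterz_ST. Qed.

Lemma translate_continuous a b : continuous (translate a b).
Proof.
by move=> x; apply: (@continuous_comp _ _ _ (iterz S b) (iterz T a));
  exact: iterz_continuous.
Qed.

Lemma distal_translate x y w : distal T S ->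
  closure [set (translate ab.1 ab.2 x, translate ab.1 ab.2 y)
          | ab in [set: int * int]] (w, w) -> x = y.
Proof.
move=> dTS clw; apply: contrapT => /dTS; set D := [set _ | _ in _] => D0.
have nb : nbhs w [set z | mdist w z < inf D / 2].
  by apply/metricType_numDomainType.nbhs_mdistP; exists (inf D / 2) => //=; rewrite divr_gt0.
have [|_ [[ab _ <-] [/= h1 h2]]] := clw ([set z | mdist w z < inf D / 2] `*`
   [set z | mdist w z < inf D / 2]).
  by exists ([set z | mdist w z < inf D / 2], [set z | mdist w z < inf D / 2]).
suff : mdist (translate ab.1 ab.2 x) (translate ab.1 ab.2 y) < inf D.
  rewrite ltNge => /negP; apply; apply: ge_inf; last by exists ab.
  by exists 0 => _ [c _ <-]; exact: mdist_ge0.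
apply: le_lt_trans (metric_triangle _ w _) _.
by rewrite metric_sym [ltRHS]splitr ltrD.
Qed.

(** The third coordinate shares its power of [S] with the first and its power of
    [T] with the second, which is what keeps [linked_triples] invariant while
    the first two coordinates move independently. *)
Definition triple_translate (g : (int * int) * (int * int)) (p : X * X * X) :
    X * X * X :=
  ((translate g.1.1 g.1.2 p.1.1, translate g.2.1 g.2.2 p.1.2),
   translate g.2.1 g.1.2 p.2).

Definition linked_triples : set (X * X * X) :=
  [set p | prolongation_graph T (p.1.1, p.2) /\ prolongation_graph S (p.1.2, p.2)].

Lemma prolongation_graph_translate_T a b c x z : prolongation_graph T (x, z) ->
  prolongation_graph T (translate a b x, translate c b z).
Proof.
apply: (@closure_map _ _ (fun p : X * X => (translate a b p.1, translate c b p.2))).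
  apply: pair_continuous => p; apply: continuous_comp;
    by [exact: cvg_fst|exact: cvg_snd|exact: translate_continuous].
move=> _ [[u k] _ <-] /=; apply: subset_closure.
exists (translate a b u, c + k - a) => //=; congr (_, _).
by rewrite [in RHS]/translate iterz_ST /translate -!iterzD subrK.
Qed.

Lemma prolongation_graph_translate_S a b c x z : prolongation_graph S (x, z) ->
  prolongation_graph S (translate a b x, translate a c z).
Proof.
apply: (@closure_map _ _ (fun p : X * X => (translate a b p.1, translate a c p.2))).
  apply: pair_continuous => p; apply: continuous_comp;
    by [exact: cvg_fst|exact: cvg_snd|exact: translate_continuous].
move=> _ [[u k] _ <-] /=; apply: subset_closure.
exists (translate a b u, c + k - b) => //=; congr (_, _).
by rewrite iterz_ST /translate -!iterzD subrK.
Qed.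

Lemma prolongation_graph_refl (F : homeomorphism X) x : prolongation_graph F (x, x).
Proof. by apply: subset_closure; exists (x, 0). Qed.

Context (TS_minimal : minimal T S) (TS_distal : distal T S).

Let family := range triple_translate.
Let Z := (X * X * X)%type.

Lemma triple_translate_continuous g : continuous (triple_translate g).
Proof.
apply: pair_continuous; first apply: pair_continuous.
- move=> p; apply: (@continuous_comp _ _ _ (fun p : Z => p.1.1)); last exact: translate_continuous.
  by apply: (@continuous_comp _ _ _ (@fst (X * X) X)); exact: cvg_fst.
- move=> p; apply: (@continuous_comp _ _ _ (fun p : Z => p.1.2)); last exact: translate_continuous.
  by apply: (@continuous_comp _ _ _ (@fst (X * X) X)); [exact: cvg_fst|exact: cvg_snd].
- by move=> p; apply: continuous_comp; [exact: cvg_snd|exact: translate_continuous].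
Qed.

Lemma triple_translate_comp g h : family (triple_translate g \o triple_translate h).
Proof.
exists ((g.1.1 + h.1.1, g.1.2 + h.1.2), (g.2.1 + h.2.1, g.2.2 + h.2.2)) => //.
by apply/funext => p; rewrite /triple_translate /= !translateD.
Qed.

(** A pair of distinct triples differs in some coordinate, on which the family acts
    by the distal action of [T] and [S]. *)
Lemma triple_translate_distal : distal_family family.
Proof.
move=> p q w clw.
have fstc (U V : topologicalType) : continuous (@fst U V) by move=> ?; exact: cvg_fst.
have sndc (U V : topologicalType) : continuous (@snd U V) by move=> ?; exact: cvg_snd.
have coord (f : Z -> X) (ab : (int * int) * (int * int) -> int * int) : continuous f ->
    (forall g z, f (triple_translate g z) = translate (ab g).1 (ab g).2 (f z)) ->
    f p = f q.
  move=> cf fab; apply: (@distal_translate _ _ (f w)) TS_distal _.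
  apply: (@closure_map _ _ (fun z : Z * Z => (f z.1, f z.2))) clw.
    by apply: pair_continuous => z; apply: continuous_comp;
       [exact: fstc|exact: cf|exact: sndc|exact: cf].
  move=> _ [_ [g _ <-] <-] /=; apply: subset_closure; exists (ab g) => //.
  by rewrite !fab.
case: p q coord {clw} => [[x y] z] [[x' y'] z'] coord.
have -> : x = x'.
  by apply: (coord (fun z => z.1.1) (fun g => g.1)) => // ?;
    apply: continuous_comp; exact: fstc.
have -> : y = y'.
  by apply: (coord (fun z => z.1.2) (fun g => g.2)) => // ?;
    apply: continuous_comp; [exact: fstc|exact: sndc].
have -> // : z = z'.
by apply: (coord snd (fun g => (g.2.1, g.1.2))) => //; exact: sndc.
Qed.

(** Minimality of the induced action on the first two coordinates: the parameters
    moving the first and those moving the second are independent. *)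
Lemma triple_translate_minimal (z : Z) b :
  closure [set (f z).1 | f in family] b.
Proof.
have orbit (x y : X) (V : set X) : nbhs y V -> exists ab, V (translate ab.1 ab.2 x).
  move=> nV; have [|w [Vw [ab _ abw]]] := TS_minimal x _ (@open_interior _ V).
    by exists y.
  by exists ab; rewrite /translate abw; exact: interior_subset.
move=> V [[V1 V2] [/= /(orbit z.1.1)[g1 h1] /(orbit z.1.2)[g2 h2]] VV].
exists (triple_translate (g1, g2) z).1; split; last exact: VV.
by exists (triple_translate (g1, g2)) => //; exists (g1, g2).
Qed.

Lemma linked_triples_closed : closed linked_triples.
Proof.
apply: (@closedI _ ((fun p : Z => (p.1.1, p.2)) @^-1` prolongation_graph T)
   ((fun p : Z => (p.1.2, p.2)) @^-1` prolongation_graph S));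
  (apply: preimage_closed; last exact: closed_closure) => p _ /=.
- apply: pair_continuous => q; last exact: cvg_snd.
  by apply: continuous_comp; exact: cvg_fst.
- apply: pair_continuous => q; last exact: cvg_snd.
  by apply: continuous_comp; [exact: cvg_fst|exact: cvg_snd].
Qed.

Lemma linked_triples_invariant f p : family f -> linked_triples p -> linked_triples (f p).
Proof.
move=> [g _ <-] [pT pS]; split.
  exact: prolongation_graph_translate_T.
exact: prolongation_graph_translate_S.
Qed.

Let compact_triples : compact [set: Z].
Proof.
rewrite -!setXTT; do 2?apply: compact_setX; exact: compact_setT.
Qed.

Let hausdorff_triples : hausdorff_space Z.
Proof. by do 2?apply: hausdorff_pair; exact: metric_hausdorff. Qed.

Let family_comp f g : family f -> family g -> family (f \o g).
Proof. by move=> [a _ <-] [b _ <-]; exact: triple_translate_comp. Qed.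

Let family_continuous f : family f -> continuous f.
Proof. by move=> [a _ <-]; exact: triple_translate_continuous. Qed.

Let family_fst f (z z' : Z) : family f -> z.1 = z'.1 -> (f z).1 = (f z').1.
Proof. by move=> [g _ <-] zz'; rewrite /triple_translate /= zz'. Qed.

Let fst_cont : continuous (fst : Z -> X * X).
Proof. by move=> ?; exact: cvg_fst. Qed.

Let hausdorff_pairs : hausdorff_space (X * X)%type.
Proof. by apply: hausdorff_pair; exact: metric_hausdorff. Qed.

Lemma linked_triples_onto (b : X * X) : exists z, linked_triples (b, z).
Proof.
have [|[b' z] Pz <-] := distal_extension_onto compact_triples
  hausdorff_pairs fst_cont triple_translate_minimal
  linked_triples_closed linked_triples_invariant _ b; last by exists z.
by exists (b.1, b.1, b.1); split; exact: prolongation_graph_refl.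
Qed.

Lemma linked_triples_open (b : X * X) z (U : set X) :
  linked_triples (b, z) -> nbhs z U ->
  \forall b' \near b, [set z' | linked_triples (b', z')] `&` U !=set0.
Proof.
move=> Pz nU.
have nU' : nbhs (b, z) ((setT : set (X * X)) `*` U).
  by exists (setT, U) => //; split=> //; exact: filterT.
apply: filterS (distal_extension_open compact_triples hausdorff_triples
  family_continuous family_comp triple_translate_distal
  hausdorff_pairs fst_cont family_fst triple_translate_minimal
  linked_triples_closed linked_triples_invariant Pz nU') => b'.
by move=> [[c z'] [Pcz' [_ /= Uz']] /= <-]; exists z'.
Qed.

Definition linked_fiber (b : X * X) : hyperspace X.
Proof.
apply: (@Hyperspace _ _ [set z | linked_triples (b, z)]).
  exact: linked_triples_onto.
have -> : [set z | linked_triples (b, z)] = pair b @^-1` linked_triples by [].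
apply: preimage_closed linked_triples_closed => z _.
by apply: pair_continuous => ?; [exact: cvg_cst|exact: cvg_id].
Defined.

Lemma linked_fiber_continuous : continuous linked_fiber.
Proof.
apply: hyperspace_continuous; last by move=> b z U; exact: linked_triples_open.
rewrite (_ : [set _ | _] = linked_triples); first exact: linked_triples_closed.
by apply/seteqP; split=> -[].
Qed.

End Z2Action.

Theorem theorem2p7 (R : realType) (X : compactMetricType R)
    (T S : homeomorphism X) (TS_comm : forall x : X, T (S x) = S (T x))
    (TS_minimal : minimal T S) (TS_distal : distal T S) :
  exists I : X * X -> hyperspace X,
    (forall x y : X, I (x, y) = prolongation T x `&` prolongation S y :> set X)
    /\ continuous I.
Proof.
exists (linked_fiber TS_comm TS_minimal); split; last exact: linked_fiber_continuous.
by move=> x y; apply/seteqP; split=> z [/prolongationE Tz /prolongationE Sz].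
Qed.
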